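(* Let $W$ be a $3$-web with nonvanishing curvature, with absolute invariants $a_1,a_2$ and invariant $1$-forms $\theta_1,\theta_2$. (i) Let $W$ be defined in a domain $D$ in which the invariants $a_1$ and $a_2$ are functionally independent and form a coordinate system. Then $W$ is locally rigid in $D$. (ii) Let the invariants $a_1$ and $a_2$ be functionally dependent in some domain $D$, say, $a_2=F(a_1)$ for a smooth function $F$, but let the differential $3$-form satisfy $$\Theta_1\wedge\Theta_2\wedge dA_1\neq 0$$ at points of the manifold $\{(p,q)\mid a_1(p)=\overline{a_1}(q),\ p\neq q\}\subset D\times D$. Then $W$ is locally rigid in this domain.
   Context: $M$ is a two-dimensional smooth manifold. A $3$-web $W$ on $M$ is given by three differential $1$-forms $\omega_1,\omega_2,\omega_3$, any two linearly independent at each point (the foliations of the web are $\{\omega_i=0\}$), normalized by $\omega_1+\omega_2+\omega_3=0$. There is a unique $1$-form $\gamma$ with $d\omega_1=\omega_1\wedge\gamma$, $d\omega_2=\omega_2\wedge\gamma$; the curvature $K$ is defined by $d\gamma=K\,\omega_1\wedge\omega_2$. It is assumed that $K$ is nowhere zero, and (changing the orientation if necessary) $K>0$, $K=k^2$ with $k>0$ smooth. Put $\theta_i=k\,\omega_i$ ($i=1,2$) and $\alpha=\gamma-dk/k$; then $d\theta_i=\theta_i\wedge\alpha$, $d\alpha=\theta_1\wedge\theta_2$. The forms $\theta_1,\theta_2$ are the invariant $1$-forms of the web, and the absolute invariants $a_1,a_2$ are the functions defined by $\alpha=a_1\theta_1+a_2\theta_2$. $W$ is locally rigid in a domain $D\subset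 M$ if for any two distinct points $p,q\in D$ there is no local diffeomorphism $\phi$ sending $p$ to $q$ and transforming the web $W$ in a neighborhood of $p$ into the web $W$ in a neighborhood of $q$. Let $\overline{W}$ be a copy of $W$ with corresponding forms $\overline{\theta}_1,\overline{\theta}_2$ and invariants $\overline{a_1},\overline{a_2}$. On $D\times D$ (unbarred objects pulled back from the first factor, barred objects from the second) put $\Theta_1=\overline{\theta}_1-\theta_1$, $\Theta_2=\overline{\theta}_2-\theta_2$, $A_1=\overline{a_1}-a_1$.
   Formalization: ''Transforming the web W into W'' means each form ω_i pulls back to a positive multiple of itself (transversal orientations kept). For unoriented foliations the claim fails: for suitable odd f the web x, y, f = const has the symmetry (x,y)→(−x,−y), although a_1, a_2 are coordinates near 0. *)

(* Defs.v *)
From Stdlib Require Export Reals.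
From Coquelicot Require Export Coquelicot.
Open Scope R_scope.

Set Implicit Arguments.
Unset Strict Implicit.
Unset Printing Implicit Defensive.

Definition plane : UniformSpace := prod_UniformSpace R_UniformSpace R_UniformSpace.

(* [ex_diff_n] at one point only speaks of derivatives there; [smooth2_at] means
   C^infinity when it holds at all points of an open set, which is how it is used. *)
Definition smooth2_at (f : R * R -> R) (z : R * R) : Prop :=
  forall n, ex_diff_n (fun x y => f (x, y)) n (fst z) (snd z).

(* The topology of a manifold is the one generated by its atlas; [param i] is the
   inverse of [chart i] and is unspecified outside the image of [chart i]. *)
Record atlas := Atlas {
  pt :> Type;
  idx : Type;
  dom : idx -> pt -> Prop;
  chart : idx -> pt -> R * R;
  param : idx -> R * R -> pt
}.

Definition m_open (M : atlas) (O : M -> Prop) : Prop :=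
  forall i : idx M,
    open (T := plane) (fun z => exists p, dom i p /\ O p /\ chart i p = z).

Record manifold2 := Manifold2 {
  atl :> atlas;
  chart_cover : forall p : atl, exists i, dom i p;
  chartK : forall (i : idx atl) (p : atl), dom i p -> param i (chart i p) = p;
  overlap_open : forall i j : idx atl,
    open (T := plane) (fun z => exists p, dom i p /\ dom j p /\ chart i p = z);
  transition_smooth : forall (i j : idx atl) (p : atl), dom i p -> dom j p ->
    smooth2_at (fun z => fst (chart j (param i z))) (chart i p) /\
    smooth2_at (fun z => snd (chart j (param i z))) (chart i p);
  hausdorff : forall p q : atl, p <> q ->
    exists O O' : atl -> Prop, m_open O /\ m_open O' /\ O p /\ O' q /\
      forall x, ~ (O x /\ O' x);
  second_countable : exists B : nat -> atl -> Prop,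
    (forall n, m_open (B n)) /\
    (forall O p, m_open O -> O p ->
       exists n, B n p /\ forall x, B n x -> O x)
}.

Section Calculus.
Variable M : manifold2.
Implicit Types (i j : idx M) (p q : M) (D O U V : M -> Prop).

Definition m_domain D : Prop :=
  m_open D /\ (exists p, D p) /\
  forall O O', m_open O -> m_open O' ->
    (forall p, D p -> O p \/ O' p) ->
    (exists p, D p /\ O p) -> (exists p, D p /\ O' p) ->
    exists p, D p /\ O p /\ O' p.

Definition smooth_at i (f : M -> R) p : Prop :=
  smooth2_at (fun z => f (param i z)) (chart i p).

Definition smooth_on O (f : M -> R) : Prop :=
  forall i p, O p -> dom i p -> smooth_at i f p.

Definition pd1 i (f : M -> R) p : R :=
  Derive (fun x => f (param i (x, snd (chart i p)))) (fst (chart i p)).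

Definition pd2 i (f : M -> R) p : R :=
  Derive (fun y => f (param i (fst (chart i p), y))) (snd (chart i p)).

(* [w i p] is the pair of coefficients at p of a 1-form w = w_1 dx + w_2 dy, in the
   coordinates (x, y) of [chart i]; a value of [two_form] is the coefficient of dx/\dy.
   Values are meaningful only when [dom i p]. *)
Definition one_form := idx M -> M -> R * R.
Definition two_form := idx M -> M -> R.

Definition eq_one_form (w h : one_form) : Prop := forall i p, dom i p -> w i p = h i p.
Definition eq_two_form (w h : two_form) : Prop := forall i p, dom i p -> w i p = h i p.

Definition zero1 : one_form := fun _ _ => (0, 0).
Definition add1 (w h : one_form) : one_form := fun i p =>
  (fst (w i p) + fst (h i p), snd (w i p) + snd (h i p)).
Definition mul1 (f : M -> R) (w : one_form) : one_form := fun i p =>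
  (f p * fst (w i p), f p * snd (w i p)).
Definition sub1 (w h : one_form) : one_form := add1 w (mul1 (fun _ => -1) h).
Definition mul2 (f : M -> R) (w : two_form) : two_form := fun i p => f p * w i p.

Definition wedge (w h : one_form) : two_form := fun i p =>
  fst (w i p) * snd (h i p) - snd (w i p) * fst (h i p).

Definition d_fun (f : M -> R) : one_form := fun i p => (pd1 i f p, pd2 i f p).

Definition d_form (w : one_form) : two_form := fun i p =>
  pd1 i (fun x => snd (w i x)) p - pd2 i (fun x => fst (w i x)) p.

(* Coefficients in [chart i] at p of the pullback of w by phi, computed from the
   coefficients of w in [chart j], for p in [dom i] and phi p in [dom j]. *)
Definition pullback (phi : M -> M) (w : one_form) i j p : R * R :=
  let x r := fst (chart j (phi r)) in
  let y r := snd (chart j (phi r)) in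
  (fst (w j (phi p)) * pd1 i x p + snd (w j (phi p)) * pd1 i y p,
   fst (w j (phi p)) * pd2 i x p + snd (w j (phi p)) * pd2 i y p).

Definition is_one_form (w : one_form) : Prop :=
  (forall i p, dom i p ->
     smooth_at i (fun x => fst (w i x)) p /\
     smooth_at i (fun x => snd (w i x)) p) /\
  (forall i j p, dom i p -> dom j p -> pullback (fun x => x) w i j p = w i p).

Definition lin_indep (w h : one_form) : Prop :=
  forall i p, dom i p -> forall s t : R,
    s * fst (w i p) + t * fst (h i p) = 0 ->
    s * snd (w i p) + t * snd (h i p) = 0 -> s = 0 /\ t = 0.

Definition smooth_map U (phi : M -> M) : Prop :=
  (forall O, m_open O -> m_open (fun x => U x /\ O (phi x))) /\
  forall i j p, U p -> dom i p -> dom j (phi p) ->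
    smooth_at i (fun x => fst (chart j (phi x))) p /\
    smooth_at i (fun x => snd (chart j (phi x))) p.

(* phi is a total function whose values outside U are irrelevant. *)
Definition diffeo U V (phi : M -> M) : Prop :=
  m_open U /\ m_open V /\ smooth_map U phi /\
  exists psi : M -> M, smooth_map V psi /\
    (forall x, U x -> V (phi x) /\ psi (phi x) = x) /\
    (forall y, V y -> U (psi y) /\ phi (psi y) = y).

Definition functionally_independent D (u v : M -> R) : Prop :=
  forall i p, D p -> dom i p -> wedge (d_fun u) (d_fun v) i p <> 0.

(* (u, v) maps D diffeomorphically onto an open subset of R^2, with inverse g. *)
Definition coordinate_system D (u v : M -> R) : Prop :=
  smooth_on D u /\ smooth_on D v /\
  (forall O, m_open O ->
     open (T := plane) (fun z => exists p, D p /\ O p /\ (u p, v p) = z)) /\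
  exists g : R * R -> M, forall p, D p ->
    g (u p, v p) = p /\
    forall i, dom i p ->
      smooth2_at (fun z => fst (chart i (g z))) (u p, v p) /\
      smooth2_at (fun z => snd (chart i (g z))) (u p, v p).

Definition functionally_dependent D (u v : M -> R) : Prop :=
  exists (J : R -> Prop) (F : R -> R),
    open (T := R_UniformSpace) J /\ (forall t n, J t -> ex_derive_n F n t) /\
    forall p, D p -> J (u p) /\ v p = F (u p).

(* Covectors on M x M at (p, q), in the product of [chart i] at p and [chart j] at q:
   the first pair holds the coefficients of dx, dy on the first factor, the second
   pair those on the second factor. *)
Definition cov4 : Type := (R * R) * (R * R).

Definition pr1_form (w : one_form) i j p q : cov4 := (w i p, (0, 0)).
Definition pr2_form (w : one_form) i j p q : cov4 := ((0, 0), w j q).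

Definition sub4 (e f : cov4) : cov4 :=
  ((fst (fst e) - fst (fst f), snd (fst e) - snd (fst f)),
   (fst (snd e) - fst (snd f), snd (snd e) - snd (snd f))).

Definition d_prod (A : M -> M -> R) i j p q : cov4 :=
  ((pd1 i (fun x => A x q) p, pd2 i (fun x => A x q) p),
   (pd1 j (fun y => A p y) q, pd2 j (fun y => A p y) q)).

Definition eval4 (e v : cov4) : R :=
  fst (fst e) * fst (fst v) + snd (fst e) * snd (fst v) +
  fst (snd e) * fst (snd v) + snd (snd e) * snd (snd v).

(* (e /\ f /\ g) (u, v, w), the determinant of the nine evaluations; u, v, w are tangent
   vectors in the same coordinates. *)
Definition wedge3 (e f g u v w : cov4) : R :=
    eval4 e u * (eval4 f v * eval4 g w - eval4 f w * eval4 g v)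
  - eval4 e v * (eval4 f u * eval4 g w - eval4 f w * eval4 g u)
  + eval4 e w * (eval4 f u * eval4 g v - eval4 f v * eval4 g u).

End Calculus.

Arguments zero1 {M}.

Record web (M : manifold2) := Web {
  omega1 : one_form M;
  omega2 : one_form M;
  omega3 : one_form M;
  omega1_form : is_one_form omega1;
  omega2_form : is_one_form omega2;
  omega3_form : is_one_form omega3;
  omega12_indep : lin_indep omega1 omega2;
  omega13_indep : lin_indep omega1 omega3;
  omega23_indep : lin_indep omega2 omega3;
  omega_sum0 : eq_one_form (add1 (add1 omega1 omega2) omega3) zero1
}.

Section Webs.
Variables (M : manifold2) (W : web M).

Definition is_connection (gamma : one_form M) : Prop :=
  is_one_form gamma /\
  eq_two_form (d_form (omega1 W)) (wedge (omega1 W) gamma) /\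
  eq_two_form (d_form (omega2 W)) (wedge (omega2 W) gamma).

Definition is_curvature (gamma : one_form M) (K : M -> R) : Prop :=
  eq_two_form (d_form gamma) (mul2 K (wedge (omega1 W) (omega2 W))).

Definition theta1 (k : M -> R) : one_form M := mul1 k (omega1 W).
Definition theta2 (k : M -> R) : one_form M := mul1 k (omega2 W).

Definition alpha (gamma : one_form M) (k : M -> R) : one_form M :=
  sub1 gamma (mul1 (fun p => / k p) (d_fun k)).

Definition are_absolute_invariants (gamma : one_form M) (k a1 a2 : M -> R) : Prop :=
  eq_one_form (alpha gamma k) (add1 (mul1 a1 (theta1 k)) (mul1 a2 (theta2 k))).

(* On U, phi maps the leaves of the (transversally oriented) foliation w = 0 to leaves
   of the same foliation, respecting the transversal orientation given by w. *)
Definition preserves_foliation (U : M -> Prop) (phi : M -> M) (w : one_form M) : Prop :=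
  forall (i j : idx M) (p : M), U p -> dom i p -> dom j (phi p) ->
    exists l : R, 0 < l /\ pullback phi w i j p = (l * fst (w i p), l * snd (w i p)).

(* The transversal orientations matter: theta1, theta2, a1, a2 all change sign when
   omega1, omega2, omega3 do. For the web x = const, y = const, f(x, y) = const with f
   odd, (x, y) -> (-x, -y) preserves each unoriented foliation but maps (a1, a2) to
   (-a1, -a2); a1, a2 may nevertheless be coordinates around 0. *)
Definition preserves_web (U : M -> Prop) (phi : M -> M) : Prop :=
  preserves_foliation U phi (omega1 W) /\
  preserves_foliation U phi (omega2 W) /\
  preserves_foliation U phi (omega3 W).

Definition locally_rigid (D : M -> Prop) : Prop :=
  forall p q : M, D p -> D q -> p <> q ->
    ~ exists (U V : M -> Prop) (phi : M -> M),
        U p /\ V q /\ diffeo U V phi /\ phi p = q /\ preserves_web U phi.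

Definition Theta (theta : one_form M) (i j : idx M) (p q : M) : cov4 :=
  sub4 (pr2_form theta i j p q) (pr1_form theta i j p q).

Definition nonzero_ThetaThetadA (k a1 : M -> R) (p q : M) : Prop :=
  forall i j : idx M, dom i p -> dom j q ->
    exists u v w : cov4,
      wedge3 (Theta (theta1 k) i j p q) (Theta (theta2 k) i j p q)
             (d_prod (fun x y => a1 y - a1 x) i j p q) u v w <> 0.

End Webs.

(* Main.v *)
Require Import Defs.
From Stdlib Require Import Lra.
Open Scope R_scope.

(** A local diffeomorphism phi that preserves the web preserves every object that
    is built canonically from it, in particular the functions a1 and a2.

    Indeed phi multiplies the three forms omega_i by functions, and the
    normalization omega1 + omega2 + omega3 = 0 makes these functions equal, so
    phi^* omega_i = l omega_i with l > 0 ([conformal_factor]). Differentiating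
    this and using d omega_i = omega_i /\ gamma gives phi^* gamma = gamma - dl/l
    ([connection_change]). As dl/l = d (ln l) is closed, gamma and phi^* gamma
    have the same exterior derivative, which reads K = (K o phi) l^2
    ([curvature_change]), that is, k = (k o phi) l. Hence the forms
    theta_i = k omega_i are preserved, the changes of gamma and of dk/k cancel in
    alpha, and a1, a2, the coefficients of alpha with respect to theta1, theta2,
    satisfy a1 o phi = a1 and a2 o phi = a2 ([invariants_invariant]).

    If (a1, a2) is injective, then phi p = q forces p = q. In the dependent case,
    the three covectors Theta1, Theta2, dA1 at (p, q) vanish on the tangent plane
    of the graph of phi, because phi preserves theta1, theta2 and a1. They lie in
    the two-dimensional annihilator of that plane, so their exterior product is
    zero ([wedge3_graph]), against the hypothesis.

    The calculus is done in one chart i around a point and one chart j around its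
    image. Differentiability of l is enough: ln l has a differentiable gradient,
    gamma - phi^* gamma, and the symmetry of its second derivatives is Young's
    theorem ([young]), which asks no more. *)

(** * Functions of two real variables *)

(** The mean value theorem in the first variable, applied to the difference of
    the slices of [f] at y + h and y, turns the mixed second difference into h
    times an increment of [u] in the second variable. The terms in [u1] cancel
    in that increment, so only the slope [u2] survives. *)
Lemma second_difference (f u : R -> R -> R) (x y u1 u2 : R) :
  locally_2d (fun a b => is_derive (fun t => f t b) a (u a b)) x y ->
  differentiable_pt_lim u x y u1 u2 ->
  forall eps : posreal, exists delta : posreal, forall h, 0 < h < delta ->
    Rabs (f (x + h) (y + h) - f x (y + h) - f (x + h) y + f x y - u2 * h ^ 2)
      <= 2 * eps * h ^ 2.
Proof.
  intros [d1 H1] Hu eps.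
  destruct (Hu eps) as [d2 H2].
  assert (Hd : 0 < Rmin d1 d2) by (apply Rmin_pos; apply cond_pos).
  exists (mkposreal _ Hd); intros h [h0 hd]; simpl in hd.
  pose proof (Rmin_l d1 d2); pose proof (Rmin_r d1 d2).
  destruct (MVT_cor2 (fun t => f t (y + h) - f t y)
              (fun t => u t (y + h) - u t y) x (x + h)) as [c [Hc Hcx]].
  - lra.
  - intros c Hc. apply is_derive_Reals. apply @is_derive_minus.
    + apply H1; rewrite Rabs_right; lra.
    + apply H1; rewrite Rabs_right; lra.
  - assert (B1 := H2 c (y + h)). assert (B2 := H2 c y).
    rewrite (Rabs_right (c - x)) in B1, B2 by lra.
    rewrite (Rabs_right (y + h - y)) in B1 by lra.
    rewrite (Rabs_right (y - y)) in B2 by lra.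
    rewrite (Rmax_right (c - x)) in B1 by lra.
    rewrite (Rmax_left (c - x)) in B2 by lra.
    specialize (B1 ltac:(lra) ltac:(lra)). specialize (B2 ltac:(lra) ltac:(lra)).
    pose proof (cond_pos eps) as He.
    assert (eps * (c - x) <= eps * h) by (apply Rmult_le_compat_l; lra).
    replace (f (x + h) (y + h) - f x (y + h) - f (x + h) y + f x y - u2 * h ^ 2)
      with (((u c (y + h) - u x y - (u1 * (c - x) + u2 * (y + h - y)))
             - (u c y - u x y - (u1 * (c - x) + u2 * (y - y)))) * h)
      by (replace (x + h - x) with h in Hc by ring; nra).
    rewrite Rabs_mult, (Rabs_right h) by lra.
    replace (2 * eps * h ^ 2) with ((2 * (eps * h)) * h) by ring.
    apply Rmult_le_compat_r; [lra|].
    eapply Rle_trans; [apply Rabs_triang|]. rewrite Rabs_Ropp.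
    replace (y + h - y) with h in * by ring. lra.
Qed.

Lemma locally_2d_swap (P : R -> R -> Prop) x y :
  locally_2d P x y -> locally_2d (fun b a => P a b) y x.
Proof. intros [d H]; exists d; intros; apply H; assumption. Qed.

Lemma differentiable_pt_lim_swap f x y a b :
  differentiable_pt_lim f x y a b ->
  differentiable_pt_lim (fun v u => f u v) y x b a.
Proof.
  intros H eps. destruct (H eps) as [d Hd]. exists d; intros v u Hv Hu.
  rewrite Rmax_comm, (Rplus_comm (b * _)). apply Hd; assumption.
Qed.

(** The mixed second difference is symmetric in the two variables, so
    [second_difference], read once in each order, gives it both leading
    coefficients. Unlike the theorem of Schwarz this asks for differentiability
    of the first partials at one point only; the gradient of the logarithm of
    the conformal factor is known in exactly that way below. *)
Lemma young (f u v : R -> R -> R) (x y u1 u2 v1 v2 : R) :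
  locally_2d (fun a b => differentiable_pt_lim f a b (u a b) (v a b)) x y ->
  differentiable_pt_lim u x y u1 u2 ->
  differentiable_pt_lim v x y v1 v2 ->
  u2 = v1.
Proof.
  intros Hf Hu Hv.
  assert (Hf1 : locally_2d (fun a b => is_derive (fun t => f t b) a (u a b)) x y).
  { revert Hf; apply locally_2d_impl, locally_2d_forall; intros a b H.
    apply is_derive_Reals.
    replace (u a b) with (u a b * 1 + v a b * 0) by ring.
    apply (derivable_pt_lim_comp_2d f (fun t => t) (fun _ => b)); auto.
    - apply derivable_pt_lim_id.
    - apply derivable_pt_lim_const. }
  assert (Hf2 : locally_2d (fun b a => is_derive (fun t => f a t) b (v a b)) y x).
  { apply locally_2d_swap.
    revert Hf; apply locally_2d_impl, locally_2d_forall; intros a b H.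
    apply is_derive_Reals.
    replace (v a b) with (u a b * 0 + v a b * 1) by ring.
    apply (derivable_pt_lim_comp_2d f (fun _ => a) (fun t => t)); auto.
    - apply derivable_pt_lim_const.
    - apply derivable_pt_lim_id. }
  apply differentiable_pt_lim_swap in Hv.
  apply Rminus_diag_uniq. apply cond_eq. intros e He.
  replace (u2 - v1 - 0) with (u2 - v1) by ring.
  assert (He' : 0 < e / 5) by lra.
  destruct (second_difference _ _ _ _ _ _ Hf1 Hu (mkposreal _ He')) as [d1 H1].
  destruct (second_difference (fun b a => f a b) _ _ _ _ _ Hf2 Hv (mkposreal _ He'))
    as [d2 H2].
  cbn [pos] in H1, H2.
  (* The two approximations bound (u2 - v1) h^2 by 4 (e/5) h^2 < e h^2. *)
  assert (Hd : 0 < Rmin d1 d2) by (apply Rmin_pos; apply cond_pos).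
  pose proof (Rmin_l d1 d2); pose proof (Rmin_r d1 d2).
  set (h := Rmin d1 d2 / 2) in *.
  specialize (H1 h ltac:(unfold h; lra)). specialize (H2 h ltac:(unfold h; lra)).
  assert (0 < h ^ 2) by (apply pow_lt; unfold h; lra).
  apply Rabs_le_between in H1. apply Rabs_le_between in H2.
  apply Rabs_def1; apply (Rmult_lt_reg_r (h ^ 2)); nra.
Qed.

Lemma smooth2_differentiable (f : R * R -> R) (z : R * R) :
  locally (T := plane) z (smooth2_at f) ->
  differentiable_pt_lim (fun x y => f (x, y)) (fst z) (snd z)
    (Derive (fun x => f (x, snd z)) (fst z)) (Derive (fun y => f (fst z, y)) (snd z)).
Proof.
  intros H.
  assert (Hz := locally_singleton _ _ H 1%nat).
  destruct z as [x y]; simpl in *.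
  apply filterdiff_differentiable_pt_lim.
  apply (is_derive_filterdiff (fun x y => f (x, y)) x y
     (fun u v => Derive (fun t => f (t, v)) u)).
  - revert H. apply filter_imp. intros [u v] Huv. simpl.
    destruct (Huv 1%nat) as [_ [H1 _]]. apply Derive_correct, H1.
  - destruct Hz as [_ [_ [H2 _]]]. apply Derive_correct, H2.
  - destruct Hz as [_ [_ [_ [[H3 _] _]]]].
    exact (proj1 (continuity_2d_pt_filterlim _ x y) H3).
Qed.

(** * Differential calculus in charts *)

Section ChartCalculus.
Context {M : manifold2}.
Implicit Types (i j : idx M) (p q x : M) (O : M -> Prop) (f g : M -> R).

(** Near the coordinates of a point, [param i] is an honest inverse of the chart
    and stays in any given neighbourhood. Every passage from points of the
    manifold to points of the plane goes through this fact. *)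
Lemma param_near i p O :
  m_open O -> O p -> dom i p ->
  locally (T := plane) (chart i p) (fun z =>
    O (param i z) /\ dom i (param i z) /\ chart i (param i z) = z).
Proof.
  intros HO Op Dp.
  refine (locally_open _ _ (HO i) _ _ _).
  - intros z [x [Dx [Ox <-]]]. rewrite chartK; auto.
  - exists p; auto.
Qed.

Lemma dom_open i : m_open (dom (a := M) i).
Proof. intros j. apply overlap_open. Qed.

Lemma holds_near_in_chart i p O (P : M -> Prop) :
  m_open O -> O p -> dom i p -> (forall x, O x -> dom i x -> P x) ->
  locally_2d (fun a b => P (param i (a, b))) (fst (chart i p)) (snd (chart i p)).
Proof.
  intros HO Op Dp HP. apply locally_2d_locally. rewrite <- surjective_pairing.
  generalize (param_near i p O HO Op Dp). apply filter_imp.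
  intros [a b] (Oz & Dz & _). apply HP; assumption.
Qed.

Lemma param_chart_pair i p :
  dom i p -> param i (fst (chart i p), snd (chart i p)) = p.
Proof. rewrite <- surjective_pairing. apply chartK. Qed.

(** Total differentiability in the given chart, with [d] the coefficients of the
    differential. Existence of the partial derivatives [pd1] and [pd2] alone
    would not support a chain rule. *)
Definition has_d i f p (d : R * R) : Prop :=
  differentiable_pt_lim (fun a b => f (param i (a, b)))
    (fst (chart i p)) (snd (chart i p)) (fst d) (snd d).

Lemma has_d_unique i f p d : has_d i f p d -> d_fun f i p = d.
Proof.
  intros H. destruct (differentiable_pt_lim_unique _ _ _ _ _ H) as [H1 H2].
  destruct d; unfold d_fun, pd1, pd2. rewrite H1, H2. reflexivity.
Qed.

Definition differentiable_at i f p : Prop := has_d i f p (d_fun f i p).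

Lemma has_d_differentiable i f p d : has_d i f p d -> differentiable_at i f p.
Proof. intros H. unfold differentiable_at. rewrite (has_d_unique _ _ _ _ H); auto. Qed.

Definition form_differentiable_at i (w : one_form M) p : Prop :=
  differentiable_at i (fun x => fst (w i x)) p /\
  differentiable_at i (fun x => snd (w i x)) p.

Lemma has_d_ext i p O f g d :
  m_open O -> O p -> dom i p -> (forall x, O x -> dom i x -> f x = g x) ->
  has_d i f p d -> has_d i g p d.
Proof.
  intros HO Op Dp E. apply differentiable_pt_lim_ext.
  exact (holds_near_in_chart i p O (fun x => f x = g x) HO Op Dp E).
Qed.

Lemma d_fun_ext i p O f g :
  m_open O -> O p -> dom i p -> (forall x, O x -> dom i x -> f x = g x) ->
  d_fun f i p = d_fun g i p.
Proof.
  intros HO Op Dp E.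
  assert (H := holds_near_in_chart i p O (fun x => f x = g x) HO Op Dp E).
  unfold d_fun, pd1, pd2. f_equal; apply Derive_ext_loc.
  - exact (locally_2d_1d_const_y _ _ _ H).
  - exact (locally_2d_1d_const_x _ _ _ H).
Qed.

Lemma d_form_ext i p O (w h : one_form M) :
  m_open O -> O p -> dom i p -> (forall x, O x -> dom i x -> w i x = h i x) ->
  d_form w i p = d_form h i p.
Proof.
  intros HO Op Dp E. unfold d_form.
  assert (E1 : d_fun (fun x => fst (w i x)) i p = d_fun (fun x => fst (h i x)) i p)
    by (apply (d_fun_ext i p O); auto; intros; rewrite E; auto).
  assert (E2 : d_fun (fun x => snd (w i x)) i p = d_fun (fun x => snd (h i x)) i p)
    by (apply (d_fun_ext i p O); auto; intros; rewrite E; auto).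
  injection E1 as _ E1. injection E2 as E2 _.
  rewrite E1, E2. reflexivity.
Qed.

(** * Rules of differentiation *)

Lemma has_d_const i p c : has_d i (fun _ => c) p (0, 0).
Proof.
  refine (differentiable_pt_lim_proj1_0 (fun _ => c) _ _ 0 _).
  apply derivable_pt_lim_const.
Qed.

(** The single source of the sum and product rules: they are the chain rule for
    addition and multiplication as functions on the plane. *)
Lemma has_d_comp2 (F : R -> R -> R) i f g p a b d e :
  dom i p -> differentiable_pt_lim F (f p) (g p) a b ->
  has_d i f p d -> has_d i g p e ->
  has_d i (fun x => F (f x) (g x)) p
    (a * fst d + b * fst e, a * snd d + b * snd e).
Proof.
  intros Dp HF Hf Hg.
  apply (differentiable_pt_lim_comp F (fun a b => f (param i (a, b)))
           (fun a b => g (param i (a, b)))); auto.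
  rewrite !param_chart_pair; auto.
Qed.

Lemma has_d_comp1 (F : R -> R) i f p a d :
  dom i p -> is_derive F (f p) a -> has_d i f p d ->
  has_d i (fun x => F (f x)) p (a * fst d, a * snd d).
Proof.
  intros Dp HF Hf.
  replace (a * fst d, a * snd d)
    with (a * fst d + 0 * fst d, a * snd d + 0 * snd d) by (f_equal; ring).
  apply (has_d_comp2 (fun u _ => F u) i f f); auto.
  apply differentiable_pt_lim_proj1_0, is_derive_Reals, HF.
Qed.

Lemma has_d_add i f g p d e :
  dom i p -> has_d i f p d -> has_d i g p e ->
  has_d i (fun x => f x + g x) p (fst d + fst e, snd d + snd e).
Proof.
  intros Dp Hf Hg.
  replace (fst d + fst e, snd d + snd e)
    with (1 * fst d + 1 * fst e, 1 * snd d + 1 * snd e) by (f_equal; ring).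
  apply has_d_comp2; auto.
  intros eps. apply locally_2d_forall; intros u v.
  replace (_ - _ - _) with 0 by ring. rewrite Rabs_R0.
  apply Rmult_le_pos; [left; apply cond_pos|].
  eapply Rle_trans; [apply Rabs_pos|apply Rmax_l].
Qed.

Lemma Rmult_differentiable_pt_lim a b : differentiable_pt_lim Rmult a b b a.
Proof.
  intros eps. exists eps; intros u v Hu Hv.
  replace (_ - _ - _) with ((u - a) * (v - b)) by ring.
  rewrite Rabs_mult. apply Rmult_le_compat; try apply Rabs_pos.
  - lra.
  - apply Rmax_r.
Qed.

Lemma has_d_mul i f g p d e :
  dom i p -> has_d i f p d -> has_d i g p e ->
  has_d i (fun x => f x * g x) p
    (g p * fst d + f p * fst e, g p * snd d + f p * snd e).
Proof. intros. apply has_d_comp2; auto. apply Rmult_differentiable_pt_lim. Qed.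

Lemma differentiable_add i f g p :
  dom i p -> differentiable_at i f p -> differentiable_at i g p ->
  differentiable_at i (fun x => f x + g x) p.
Proof. intros Dp Hf Hg. eapply has_d_differentiable, has_d_add; eauto. Qed.

Lemma differentiable_mul i f g p :
  dom i p -> differentiable_at i f p -> differentiable_at i g p ->
  differentiable_at i (fun x => f x * g x) p.
Proof. intros Dp Hf Hg. eapply has_d_differentiable, has_d_mul; eauto. Qed.

Lemma differentiable_const i c p : differentiable_at i (fun _ => c) p.
Proof. eapply has_d_differentiable, has_d_const. Qed.

Lemma differentiable_inv i f p :
  dom i p -> f p <> 0 -> differentiable_at i f p ->
  differentiable_at i (fun x => / f x) p.
Proof.
  intros Dp H0 Hf. eapply has_d_differentiable, has_d_comp1; eauto.
  apply (is_derive_inv (fun t : R => t)); auto. apply @is_derive_id.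
Qed.

Lemma differentiable_sub i f g p :
  dom i p -> differentiable_at i f p -> differentiable_at i g p ->
  differentiable_at i (fun x => f x - g x) p.
Proof.
  intros Dp Hf Hg.
  assert (H := differentiable_add i f (fun x => (-1) * g x) p Dp Hf
    (differentiable_mul i _ _ p Dp (differentiable_const i (-1) p) Hg)).
  eapply has_d_differentiable. refine (has_d_ext i p (dom i) (fun x => f x + (-1) * g x) _ _ (dom_open i) Dp Dp _ H).
  intros; ring.
Qed.

Lemma wedge_differentiable i (w h : one_form M) p :
  dom i p -> form_differentiable_at i w p -> form_differentiable_at i h p ->
  differentiable_at i (wedge w h i) p.
Proof.
  intros Dp [H1 H2] [H3 H4]. unfold wedge.
  apply differentiable_sub; auto; apply differentiable_mul; auto.
Qed.

Lemma form_differentiable_add1 i (w h : one_form M) p :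
  dom i p -> form_differentiable_at i w p -> form_differentiable_at i h p ->
  form_differentiable_at i (add1 w h) p.
Proof. intros Dp [] []; split; apply differentiable_add; auto. Qed.

Lemma form_differentiable_mul1 i f (w : one_form M) p :
  dom i p -> differentiable_at i f p -> form_differentiable_at i w p ->
  form_differentiable_at i (mul1 f w) p.
Proof. intros Dp ? []; split; apply differentiable_mul; auto. Qed.

Lemma form_differentiable_sub1 i (w h : one_form M) p :
  dom i p -> form_differentiable_at i w p -> form_differentiable_at i h p ->
  form_differentiable_at i (sub1 w h) p.
Proof.
  intros. apply form_differentiable_add1; auto.
  apply form_differentiable_mul1; auto. apply differentiable_const.
Qed.

Lemma d_fun_mul i f g p :
  dom i p -> differentiable_at i f p -> differentiable_at i g p ->
  d_fun (fun x => f x * g x) i p = add1 (mul1 g (d_fun f)) (mul1 f (d_fun g)) i p.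
Proof. intros. apply has_d_unique, has_d_mul; auto. Qed.

Lemma d_form_mul1 i f (w : one_form M) p :
  dom i p -> differentiable_at i f p -> form_differentiable_at i w p ->
  d_form (mul1 f w) i p = wedge (d_fun f) w i p + f p * d_form w i p.
Proof.
  intros Dp Hf [H1 H2].
  assert (E1 := d_fun_mul i _ _ p Dp Hf H1). assert (E2 := d_fun_mul i _ _ p Dp Hf H2).
  injection E1 as _ E1. injection E2 as E2 _.
  unfold d_form, mul1; simpl. rewrite E1, E2. unfold wedge; simpl. ring.
Qed.

Lemma d_form_add1 i (w h : one_form M) p :
  dom i p -> form_differentiable_at i w p -> form_differentiable_at i h p ->
  d_form (add1 w h) i p = d_form w i p + d_form h i p.
Proof.
  intros Dp [H1 H2] [H3 H4].
  assert (E1 := has_d_unique i _ p _ (has_d_add i (fun x => fst (w i x))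
    (fun x => fst (h i x)) p _ _ Dp H1 H3)).
  assert (E2 := has_d_unique i _ p _ (has_d_add i (fun x => snd (w i x))
    (fun x => snd (h i x)) p _ _ Dp H2 H4)).
  injection E1 as _ E1. injection E2 as E2 _.
  unfold d_form, add1; simpl. rewrite E1, E2; simpl. ring.
Qed.

Lemma d_form_sub1 i (w h : one_form M) p :
  dom i p -> form_differentiable_at i w p -> form_differentiable_at i h p ->
  d_form (sub1 w h) i p = d_form w i p - d_form h i p.
Proof.
  intros Dp Hw Hh. unfold sub1.
  assert (C := differentiable_const i (-1) p).
  rewrite d_form_add1, d_form_mul1; auto using form_differentiable_mul1.
  unfold wedge. rewrite (has_d_unique i _ p _ (has_d_const i p (-1))). simpl. ring.
Qed.

(** The identity ddf = 0, for a form [w] that is known to be df near p. *)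
Lemma closed_of_exact i O f (w : one_form M) p :
  m_open O -> O p -> dom i p ->
  (forall x, O x -> dom i x -> has_d i f x (w i x)) ->
  form_differentiable_at i w p ->
  d_form w i p = 0.
Proof.
  intros HO Op Dp H [H1 H2]. unfold d_form. apply Rminus_diag_eq.
  symmetry. refine (young (fun a b => f (param i (a, b))) _ _ _ _ _ _ _ _ _ H1 H2).
  apply locally_2d_locally. rewrite <- surjective_pairing.
  generalize (param_near i p O HO Op Dp). apply filter_imp.
  intros [a b] (Oz & Dz & Ez). generalize (H _ Oz Dz). unfold has_d.
  rewrite Ez. auto.
Qed.

(** * Smooth functions and forms are differentiable *)

Lemma smooth_differentiable i O f p :
  m_open O -> (forall x, O x -> dom i x -> smooth_at i f x) -> O p -> dom i p ->
  differentiable_at i f p.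
Proof.
  intros HO H Op Dp.
  apply (smooth2_differentiable (fun z => f (param i z))).
  generalize (param_near i p O HO Op Dp). apply filter_imp.
  intros z (Oz & Dz & Ez). rewrite <- Ez. apply H; auto.
Qed.

(** The partial derivatives in a chart evaluate [chart i] at the varying point,
    so they agree with those of the coordinate expression only where
    [param_near] applies. *)
Lemma smooth_pd i O f p :
  m_open O -> (forall x, O x -> dom i x -> smooth_at i f x) -> O p -> dom i p ->
  smooth_at i (pd1 i f) p /\ smooth_at i (pd2 i f) p.
Proof.
  intros HO H Op Dp.
  assert (N : locally_2d (fun a b => chart i (param i (a, b)) = (a, b))
    (fst (chart i p)) (snd (chart i p))).
  { apply locally_2d_locally. rewrite <- surjective_pairing.
    generalize (param_near i p O HO Op Dp). apply filter_imp.
    intros [a b] (_ & _ & E). exact E. }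
  split; intros n.
  - refine (ex_diff_n_ext_loc _ _ _ _ _ _
      (ex_diff_n_deriv_aux1 _ _ _ _ (H p Op Dp (S n)))).
    revert N; apply locally_2d_impl, locally_2d_forall; intros a b E.
    unfold pd1; rewrite E; reflexivity.
  - refine (ex_diff_n_ext_loc _ _ _ _ _ _
      (ex_diff_n_deriv_aux2 _ _ _ _ (H p Op Dp (S n)))).
    revert N; apply locally_2d_impl, locally_2d_forall; intros a b E.
    unfold pd2; rewrite E; reflexivity.
Qed.

Lemma smooth_d_fun_differentiable i O f p :
  m_open O -> (forall x, O x -> dom i x -> smooth_at i f x) -> O p -> dom i p ->
  form_differentiable_at i (d_fun f) p.
Proof.
  intros HO H Op Dp.
  split; apply (smooth_differentiable i O); auto; intros; apply (smooth_pd i O); auto.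
Qed.

Lemma one_form_differentiable i (w : one_form M) p :
  is_one_form w -> dom i p -> form_differentiable_at i w p.
Proof.
  intros [H _] Dp; split; apply (smooth_differentiable i (dom i)); auto using dom_open;
  intros; apply H; auto.
Qed.

(** If the determinant vanished, its cofactors would be the coefficients of a
    linear relation. *)
Lemma lin_indep_wedge (w h : one_form M) i p :
  lin_indep w h -> dom i p -> wedge w h i p <> 0.
Proof.
  intros H Dp E. unfold wedge in E.
  destruct (H i p Dp (snd (h i p)) (- snd (w i p))) as [A B]; [lra|ring|].
  destruct (H i p Dp (fst (h i p)) (- fst (w i p))) as [A' B']; [ring|lra|].
  destruct (H i p Dp 1 0); lra.
Qed.

(** * Pullback of forms *)

Section Pullback.
Variables (O : M -> Prop) (phi : M -> M) (i j : idx M).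
Hypothesis source_open : m_open O.
Hypothesis phi_dom : forall x, O x -> dom j (phi x).
Hypothesis phi_smooth : forall x, O x -> dom i x ->
  smooth_at i (fun r => fst (chart j (phi r))) x /\
  smooth_at i (fun r => snd (chart j (phi r))) x.

Let X r := fst (chart j (phi r)).
Let Y r := snd (chart j (phi r)).

(** The chart [j] at the image point is fixed, which makes the pullback a family
    of coefficients indexed by source charts only, to which [d_form] applies. *)
Definition pullback_form (w : one_form M) : one_form M := fun i => pullback phi w i j.

Definition jacobian p : R := pd1 i X p * pd2 i Y p - pd2 i X p * pd1 i Y p.

Lemma X_differentiable p : O p -> dom i p -> differentiable_at i X p.
Proof.
  intros; apply (smooth_differentiable i O); auto. intros; apply phi_smooth; auto.
Qed.

Lemma Y_differentiable p : O p -> dom i p -> differentiable_at i Y p.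
Proof.
  intros; apply (smooth_differentiable i O); auto. intros; apply phi_smooth; auto.
Qed.

(** The chain rule, in the form phi^* (df) = d (f o phi). *)
Lemma has_d_pullback f p :
  O p -> dom i p -> differentiable_at j f (phi p) ->
  has_d i (fun x => f (phi x)) p (pullback phi (d_fun f) i j p).
Proof.
  intros Op Dp Hf.
  apply (has_d_ext i p O (fun x => f (param j (X x, Y x)))); auto.
  - intros x Ox _. unfold X, Y. rewrite param_chart_pair; auto.
  - apply (has_d_comp2 (fun u v => f (param j (u, v))) i X Y p _ _
      (d_fun X i p) (d_fun Y i p)); auto.
    + apply X_differentiable; auto.
    + apply Y_differentiable; auto.
Qed.

Lemma differentiable_pullback f p :
  O p -> dom i p -> differentiable_at j f (phi p) ->
  differentiable_at i (fun x => f (phi x)) p.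
Proof. intros; eapply has_d_differentiable, has_d_pullback; auto. Qed.

Lemma pullback_d_fun f p :
  O p -> dom i p -> differentiable_at j f (phi p) ->
  pullback phi (d_fun f) i j p = d_fun (fun x => f (phi x)) i p.
Proof. intros; symmetry; apply has_d_unique, has_d_pullback; auto. Qed.

Lemma pullback_mul1 f (w : one_form M) p :
  pullback_form (mul1 f w) i p = mul1 (fun x => f (phi x)) (pullback_form w) i p.
Proof. unfold pullback_form, pullback, mul1; simpl. f_equal; ring. Qed.

Lemma pullback_add1 (w h : one_form M) p :
  pullback_form (add1 w h) i p = add1 (pullback_form w) (pullback_form h) i p.
Proof. unfold pullback_form, pullback, add1; simpl. f_equal; ring. Qed.

Lemma pullback_ext (w h : one_form M) p :
  w j (phi p) = h j (phi p) -> pullback_form w i p = pullback_form h i p.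
Proof. intros E. unfold pullback_form, pullback. rewrite E. reflexivity. Qed.

Lemma wedge_pullback (w h : one_form M) p :
  wedge (pullback_form w) (pullback_form h) i p = wedge w h j (phi p) * jacobian p.
Proof. unfold wedge, pullback_form, pullback, jacobian, X, Y; simpl. ring. Qed.

Lemma dX_dY_differentiable p : O p -> dom i p ->
  form_differentiable_at i (d_fun X) p /\ form_differentiable_at i (d_fun Y) p.
Proof.
  intros; split; apply (smooth_d_fun_differentiable i O); auto;
  intros; apply phi_smooth; auto.
Qed.

Lemma pullback_form_differentiable (w : one_form M) p :
  O p -> dom i p -> form_differentiable_at j w (phi p) ->
  form_differentiable_at i (pullback_form w) p.
Proof.
  intros Op Dp [H1 H2].
  destruct (dX_dY_differentiable p Op Dp).
  apply (form_differentiable_add1 i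
    (mul1 (fun x => fst (w j (phi x))) (d_fun X))
    (mul1 (fun x => snd (w j (phi x))) (d_fun Y))); auto;
  apply form_differentiable_mul1; auto;
  [apply (differentiable_pullback _ p Op Dp H1)|apply (differentiable_pullback _ p Op Dp H2)].
Qed.

(** Pullback commutes with d. After the product rule the only terms besides
    those in the differentials of the coefficients of [w] are the second
    derivatives of the coordinates X and Y of phi, and these are ddX = ddY = 0. *)
Lemma d_form_pullback (w : one_form M) p :
  O p -> dom i p -> form_differentiable_at j w (phi p) ->
  d_form (pullback_form w) i p = d_form w j (phi p) * jacobian p.
Proof.
  intros Op Dp [H1 H2].
  destruct (dX_dY_differentiable p Op Dp) as [DX DY].
  assert (P1 := differentiable_pullback _ p Op Dp H1).
  assert (P2 := differentiable_pullback _ p Op Dp H2).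
  transitivity (d_form (add1 (mul1 (fun x => fst (w j (phi x))) (d_fun X))
       (mul1 (fun x => snd (w j (phi x))) (d_fun Y))) i p); [reflexivity|].
  rewrite d_form_add1, !d_form_mul1; auto using form_differentiable_mul1.
  rewrite (closed_of_exact i O X (d_fun X) p); auto.
  2: intros; apply X_differentiable; auto.
  rewrite (closed_of_exact i O Y (d_fun Y) p); auto.
  2: intros; apply Y_differentiable; auto.
  assert (Q1 := pullback_d_fun _ p Op Dp H1).
  assert (Q2 := pullback_d_fun _ p Op Dp H2).
  unfold wedge. rewrite <- Q1, <- Q2.
  unfold pullback, d_form, d_fun, jacobian; simpl. fold X Y. ring.
Qed.

End Pullback.
End ChartCalculus.

(** * Invariance of the web data *)

(** The wedge product of covectors of a plane is a nondegenerate pairing; this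
    is the form in which an identity between 1-forms is deduced from its wedge
    products with the coframe. *)
Lemma wedge_cancel (a b c d u v : R) :
  a * d - b * c <> 0 -> a * v - b * u = 0 -> c * v - d * u = 0 -> u = 0 /\ v = 0.
Proof.
  intros H E1 E2; split; apply (Rmult_eq_reg_l (a * d - b * c)); auto.
  - transitivity (c * (a * v - b * u) - a * (c * v - d * u)); [ring|].
    rewrite E1, E2; ring.
  - transitivity (d * (a * v - b * u) - b * (c * v - d * u)); [ring|].
    rewrite E1, E2; ring.
Qed.

Section Invariance.
Variables (M : manifold2) (W : web M).
Variables (gamma : one_form M) (K k a1 a2 : M -> R).
Hypothesis h_gamma : is_connection W gamma.
Hypothesis h_K : is_curvature W gamma K.
Hypothesis h_k : smooth_on (fun _ : M => True) k.
Hypothesis h_Kk : forall p : M, 0 < k p /\ K p = k p ^ 2.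
Hypothesis h_a : are_absolute_invariants W gamma k a1 a2.

Lemma omega12_wedge i p : dom i p -> wedge (omega1 W) (omega2 W) i p <> 0.
Proof. apply lin_indep_wedge, omega12_indep. Qed.

Lemma theta12_wedge i p : dom i p -> wedge (theta1 W k) (theta2 W k) i p <> 0.
Proof.
  intros Dp. destruct (h_Kk p) as [k0 _].
  replace (wedge _ _ i p) with (k p ^ 2 * wedge (omega1 W) (omega2 W) i p)
    by (unfold wedge, theta1, theta2, mul1; simpl; ring).
  apply Rmult_integral_contrapositive; split; [apply pow_nonzero; lra|].
  apply omega12_wedge, Dp.
Qed.

Lemma k_differentiable i p : dom i p -> differentiable_at i k p.
Proof.
  intros Dp. apply (smooth_differentiable i (dom i)); auto using dom_open.
Qed.

Lemma dk_differentiable i p : dom i p -> form_differentiable_at i (d_fun k) p.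
Proof.
  intros Dp. apply (smooth_d_fun_differentiable i (dom i)); auto using dom_open.
Qed.

(** Cramer's rule: a1 is the quotient of alpha /\ theta2 by theta1 /\ theta2. *)
Lemma a1_differentiable i p : dom i p -> differentiable_at i a1 p.
Proof.
  intros Dp.
  assert (T1 : form_differentiable_at i (theta1 W k) p)
    by (apply form_differentiable_mul1; auto using k_differentiable;
        apply one_form_differentiable; auto; apply omega1_form).
  assert (T2 : form_differentiable_at i (theta2 W k) p)
    by (apply form_differentiable_mul1; auto using k_differentiable;
        apply one_form_differentiable; auto; apply omega2_form).
  assert (TA : form_differentiable_at i (alpha gamma k) p).
  { apply form_differentiable_sub1; auto.
    - apply one_form_differentiable; auto; apply h_gamma.
    - apply form_differentiable_mul1; auto using dk_differentiable.
      apply differentiable_inv; auto using k_differentiable.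
      destruct (h_Kk p); lra. }
  eapply has_d_differentiable.
  apply (has_d_ext i p (dom i) (fun x => wedge (alpha gamma k) (theta2 W k) i x
           * / wedge (theta1 W k) (theta2 W k) i x)); auto using dom_open.
  2: apply differentiable_mul; auto using wedge_differentiable;
     apply differentiable_inv; auto using wedge_differentiable, theta12_wedge.
  intros x Dx _. assert (N := theta12_wedge i x Dx).
  apply (Rmult_eq_reg_r _ _ _) with (2 := N).
  rewrite Rmult_assoc, Rinv_l, Rmult_1_r by exact N.
  unfold wedge. rewrite (h_a i x Dx). unfold add1, mul1; simpl. ring.
Qed.

Section Symmetry.
Variables (U : M -> Prop) (phi : M -> M).
Hypothesis phi_smooth : smooth_map U phi.
Hypothesis phi_web : preserves_web W U phi.
Variables i j : idx M.

(* The part of U that phi sends into the domain of chart j. *)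
Let O x := U x /\ dom j (phi x).

Lemma source_open : m_open O.
Proof. apply phi_smooth, dom_open. Qed.

Lemma source_image x : O x -> dom j (phi x).
Proof. intros H; apply H. Qed.

Lemma source_smooth x : O x -> dom i x ->
  smooth_at i (fun r => fst (chart j (phi r))) x /\
  smooth_at i (fun r => snd (chart j (phi r))) x.
Proof. intros [Ux Dx] Dx'. apply phi_smooth; auto. Qed.

Local Notation P := (pullback_form phi j).

(** Each omega is multiplied by its own factor; the relation
    omega1 + omega2 + omega3 = 0 holds at p and at phi p, and comparing the two
    forces the three factors to be equal. *)
Lemma conformal_factor p : O p -> dom i p -> exists l, 0 < l /\
  P (omega1 W) i p = mul1 (fun _ => l) (omega1 W) i p /\
  P (omega2 W) i p = mul1 (fun _ => l) (omega2 W) i p.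
Proof.
  intros [Up Dq] Dp.
  destruct phi_web as [H1 [H2 H3]].
  destruct (H1 i j p Up Dp Dq) as [l1 [L1 E1]].
  destruct (H2 i j p Up Dp Dq) as [l2 [L2 E2]].
  destruct (H3 i j p Up Dp Dq) as [l3 [L3 E3]].
  assert (Sp := @omega_sum0 M W i p Dp). assert (Sq := @omega_sum0 M W j (phi p) Dq).
  assert (Hl : l1 - l3 = 0 /\ l2 - l3 = 0).
  { injection E1 as E11 E12. injection E2 as E21 E22. injection E3 as E31 E32.
    injection Sp as Sp1 Sp2. injection Sq as Sq1 Sq2.
    apply (@omega12_indep M W i p Dp).
    - transitivity (l1 * fst (omega1 W i p) + l2 * fst (omega2 W i p)
        + l3 * fst (omega3 W i p)); [|rewrite <- E11, <- E21, <- E31].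
      + replace (fst (omega3 W i p))
          with (- fst (omega1 W i p) - fst (omega2 W i p)) by lra. ring.
      + replace (fst (omega3 W j (phi p)))
          with (- fst (omega1 W j (phi p)) - fst (omega2 W j (phi p))) by lra.
        replace (snd (omega3 W j (phi p)))
          with (- snd (omega1 W j (phi p)) - snd (omega2 W j (phi p))) by lra. ring.
    - transitivity (l1 * snd (omega1 W i p) + l2 * snd (omega2 W i p)
        + l3 * snd (omega3 W i p)); [|rewrite <- E12, <- E22, <- E32].
      + replace (snd (omega3 W i p))
          with (- snd (omega1 W i p) - snd (omega2 W i p)) by lra. ring.
      + replace (fst (omega3 W j (phi p)))
          with (- fst (omega1 W j (phi p)) - fst (omega2 W j (phi p))) by lra.
        replace (snd (omega3 W j (phi p)))
          with (- snd (omega1 W j (phi p)) - snd (omega2 W j (phi p))) by lra. ring. }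
  exists l1. split; [exact L1|split; [exact E1|]].
  replace l1 with l2 by lra. exact E2.
Qed.

(** A formula for the conformal factor that is visibly differentiable. *)
Definition scale x : R :=
  wedge (P (omega1 W)) (omega2 W) i x / wedge (omega1 W) (omega2 W) i x.

Lemma scale_spec p : O p -> dom i p -> 0 < scale p /\
  P (omega1 W) i p = mul1 scale (omega1 W) i p /\
  P (omega2 W) i p = mul1 scale (omega2 W) i p.
Proof.
  intros Op Dp. destruct (conformal_factor p Op Dp) as [l [L [E1 E2]]].
  assert (N := omega12_wedge i p Dp).
  assert (E : scale p = l).
  { unfold scale. replace (wedge (P (omega1 W)) (omega2 W) i p)
      with (l * wedge (omega1 W) (omega2 W) i p); [field; exact N|].
    unfold wedge. rewrite E1. unfold mul1; simpl; ring. }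
  rewrite E. split; [exact L|]. rewrite E1, E2. unfold mul1. rewrite E. auto.
Qed.

Lemma pullback_differentiable (w : one_form M) p :
  is_one_form w -> O p -> dom i p -> form_differentiable_at i (P w) p.
Proof.
  intros Hw Op Dp.
  apply (pullback_form_differentiable O phi i j); auto using source_open, source_image, source_smooth.
  apply one_form_differentiable; auto using source_image.
Qed.

Lemma scale_differentiable p : O p -> dom i p -> differentiable_at i scale p.
Proof.
  intros Op Dp.
  assert (H1 := one_form_differentiable i _ p (omega1_form W) Dp).
  assert (H2 := one_form_differentiable i _ p (omega2_form W) Dp).
  assert (H3 := pullback_differentiable _ p (omega1_form W) Op Dp).
  unfold scale, Rdiv. apply differentiable_mul; auto using wedge_differentiable.
  apply differentiable_inv; auto using wedge_differentiable, omega12_wedge.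
Qed.

(** Both sides of phi^* w = l w are differentiated, using dw = w /\ gamma on
    each side: dl /\ w + l w /\ gamma = l w /\ phi^* gamma. *)
Lemma structure_equation_pullback (w : one_form M) p :
  is_one_form w -> eq_two_form (d_form w) (wedge w gamma) ->
  (forall x, O x -> dom i x -> P w i x = mul1 scale w i x) ->
  O p -> dom i p ->
  wedge w (sub1 (mul1 scale (sub1 gamma (P gamma))) (d_fun scale)) i p = 0.
Proof.
  intros Hw Ew Hl Op Dp.
  assert (Dw := one_form_differentiable i _ p Hw Dp).
  assert (E : wedge (d_fun scale) w i p + scale p * wedge w gamma i p
              = wedge (P w) (P gamma) i p).
  { rewrite <- (Ew i p Dp), <- d_form_mul1; auto using scale_differentiable.
    rewrite <- (d_form_ext i p O (P w)); auto using source_open.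
    rewrite (d_form_pullback O phi i j);
      auto using source_open, source_image, source_smooth, one_form_differentiable.
    rewrite (Ew j _ (source_image p Op)), (wedge_pullback phi i j). reflexivity. }
  revert E. unfold wedge at 3. rewrite (Hl p Op Dp).
  unfold wedge, sub1, add1, mul1; simpl. intros E. lra.
Qed.

(** The structure equations of omega1 and omega2 together determine the change
    of gamma: phi^* gamma = gamma - dl / l. *)
Lemma connection_change p : O p -> dom i p ->
  sub1 gamma (P gamma) i p = mul1 (fun x => / scale x) (d_fun scale) i p.
Proof.
  intros Op Dp. destruct h_gamma as [_ [G1 G2]].
  destruct (scale_spec p Op Dp) as [L _].
  assert (E1 := structure_equation_pullback _ p (omega1_form W) G1
    (fun x Ox Dx => proj1 (proj2 (scale_spec x Ox Dx))) Op Dp).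
  assert (E2 := structure_equation_pullback _ p (omega2_form W) G2
    (fun x Ox Dx => proj2 (proj2 (scale_spec x Ox Dx))) Op Dp).
  destruct (wedge_cancel _ _ _ _ _ _ (omega12_wedge i p Dp) E1 E2) as [F1 F2].
  unfold sub1, add1, mul1 in *; simpl in *.
  f_equal; apply (Rmult_eq_reg_l (scale p)); try lra;
    rewrite <- Rmult_assoc, Rinv_r by lra; lra.
Qed.

(** By [connection_change], gamma - phi^* gamma is the differential of ln l, so
    gamma and phi^* gamma have the same exterior derivative. Writing both as
    multiples of omega1 /\ omega2 gives the claim, the factor l^2 coming from
    phi^* (omega1 /\ omega2). *)
Lemma curvature_change p : O p -> dom i p -> K p = K (phi p) * scale p ^ 2.
Proof.
  intros Op Dp. destruct h_gamma as [G _].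
  assert (DG := one_form_differentiable i _ p G Dp).
  assert (DP := pullback_differentiable _ p G Op Dp).
  assert (C : d_form (sub1 gamma (P gamma)) i p = 0).
  { apply (closed_of_exact i O (fun x => ln (scale x)));
      auto using source_open, form_differentiable_sub1.
    intros x Ox Dx. rewrite (connection_change x Ox Dx).
    destruct (scale_spec x Ox Dx) as [L _].
    apply has_d_comp1; auto using is_derive_ln.
    apply scale_differentiable; auto. }
  rewrite d_form_sub1 in C by auto.
  rewrite (d_form_pullback O phi i j) in C;
    auto using source_open, source_image, source_smooth, one_form_differentiable.
  rewrite (h_K i p Dp), (h_K j _ (source_image p Op)) in C.
  unfold mul2 in C. rewrite Rmult_assoc, <- (wedge_pullback phi i j) in C.
  destruct (scale_spec p Op Dp) as [_ [E1 E2]].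
  assert (N := omega12_wedge i p Dp).
  apply (Rmult_eq_reg_r (wedge (omega1 W) (omega2 W) i p)); auto.
  apply Rminus_diag_uniq in C. rewrite C.
  unfold wedge. rewrite E1, E2. unfold mul1; simpl. ring.
Qed.

(** The positive square root of [curvature_change]: this is what makes
    theta = k omega invariant. *)
Lemma k_change p : O p -> dom i p -> k p = k (phi p) * scale p.
Proof.
  intros Op Dp. assert (E := curvature_change p Op Dp).
  destruct (scale_spec p Op Dp) as [L _].
  destruct (h_Kk p) as [k0 Ek]. destruct (h_Kk (phi p)) as [k0' Ek'].
  rewrite Ek, Ek' in E.
  assert (0 < k (phi p) * scale p) by (apply Rmult_lt_0_compat; auto).
  apply Rsqr_inj; [lra|lra|]. unfold Rsqr. lra.
Qed.

Lemma theta_invariant (w : one_form M) p : O p -> dom i p ->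
  P w i p = mul1 scale w i p -> P (mul1 k w) i p = mul1 k w i p.
Proof.
  intros Op Dp E. rewrite pullback_mul1. unfold mul1 at 1. rewrite E.
  unfold mul1; simpl. rewrite (k_change p Op Dp). f_equal; ring.
Qed.

Lemma theta1_invariant p : O p -> dom i p -> P (theta1 W k) i p = theta1 W k i p.
Proof. intros. apply theta_invariant; auto. apply scale_spec; auto. Qed.

Lemma theta2_invariant p : O p -> dom i p -> P (theta2 W k) i p = theta2 W k i p.
Proof. intros. apply theta_invariant; auto. apply scale_spec; auto. Qed.

(** Since k = (k o phi) l, the logarithmic differential dk / k exceeds
    d (k o phi) / (k o phi) by dl / l, which is the amount by which gamma exceeds
    phi^* gamma. *)
Lemma alpha_invariant p : O p -> dom i p ->
  P (alpha gamma k) i p = alpha gamma k i p.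
Proof.
  intros Op Dp. destruct (scale_spec p Op Dp) as [L _].
  destruct (h_Kk (phi p)) as [k0 _].
  assert (Dk := k_differentiable j _ (source_image p Op)).
  assert (E := connection_change p Op Dp).
  assert (Ed : d_fun k i p = add1 (mul1 scale (P (d_fun k)))
                               (mul1 (fun x => k (phi x)) (d_fun scale)) i p).
  { rewrite (d_fun_ext i p O k (fun x => k (phi x) * scale x));
      auto using source_open, k_change.
    rewrite d_fun_mul; auto using scale_differentiable.
    - unfold add1, mul1, pullback_form.
      rewrite (pullback_d_fun O phi i j); auto using source_open, source_image, source_smooth.
    - apply (differentiable_pullback O phi i j); auto using source_open, source_image, source_smooth. }
  unfold alpha, sub1, add1, mul1. rewrite Ed. rewrite (k_change p Op Dp).
  unfold sub1, add1, mul1 in *. injection E as E1 E2.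
  unfold pullback_form, pullback in *; simpl in *.
  f_equal.
  - transitivity (fst (gamma i p) + - (/ scale p * pd1 i scale p)
      - / k (phi p) * fst (pullback phi (d_fun k) i j p)).
    + rewrite <- E1. unfold pullback, d_fun; simpl. ring.
    + unfold pullback, d_fun; simpl. field; lra.
  - transitivity (snd (gamma i p) + - (/ scale p * pd2 i scale p)
      - / k (phi p) * snd (pullback phi (d_fun k) i j p)).
    + rewrite <- E2. unfold pullback, d_fun; simpl. ring.
    + unfold pullback, d_fun; simpl. field; lra.
Qed.

(** a1 and a2 are the coordinates of alpha in the coframe theta1, theta2, and phi
    preserves all three forms. *)
Lemma invariants_invariant p : O p -> dom i p ->
  a1 (phi p) = a1 p /\ a2 (phi p) = a2 p.
Proof.
  intros Op Dp.
  assert (E : P (add1 (mul1 a1 (theta1 W k)) (mul1 a2 (theta2 W k))) i p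
            = add1 (mul1 a1 (theta1 W k)) (mul1 a2 (theta2 W k)) i p).
  { rewrite <- (h_a i p Dp), <- alpha_invariant by auto.
    apply pullback_ext. symmetry. apply h_a, source_image, Op. }
  assert (N := theta12_wedge i p Dp).
  rewrite pullback_add1 in E. unfold add1 in E. rewrite !pullback_mul1 in E.
  unfold mul1 in E. rewrite theta1_invariant, theta2_invariant in E by auto.
  assert (E1 := f_equal fst E). assert (E2 := f_equal snd E). cbn [fst snd] in E1, E2.
  destruct (wedge_cancel (fst (theta1 W k i p)) (fst (theta2 W k i p))
    (snd (theta1 W k i p)) (snd (theta2 W k i p))
    (a2 p - a2 (phi p)) (- (a1 p - a1 (phi p)))) as [F1 F2]; [| | |lra].
  - intros F; apply N. unfold wedge. lra.
  - lra.
  - lra.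
Qed.

End Symmetry.
End Invariance.

(** * Local rigidity *)

Section Graph.
Context {M : manifold2}.
Implicit Types (i j : idx M) (p q : M).

(** A covector pr2^* h - pr1^* phi^* h is annihilated by all vectors (v, dphi v),
    that is, by the tangent plane of the graph of phi. The annihilator of a plane
    in dimension four has dimension two, so any three such covectors are
    dependent. *)
Lemma wedge3_graph (phi : M -> M) (w1 w2 w3 : one_form M) i j p q (u v w : cov4) :
  q = phi p ->
  let graph_form h := sub4 (pr2_form h i j p q) (pr1_form (pullback_form phi j h) i j p q) in
  wedge3 (graph_form w1) (graph_form w2) (graph_form w3) u v w = 0.
Proof.
  intros ->. unfold wedge3, eval4, sub4, pr1_form, pr2_form, pullback_form, pullback; simpl.
  ring.
Qed.

Lemma d_difference (f : M -> R) i j p q :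
  dom i p -> dom j q -> differentiable_at i f p -> differentiable_at j f q ->
  d_prod (fun x y => f y - f x) i j p q
  = sub4 (pr2_form (d_fun f) i j p q) (pr1_form (d_fun f) i j p q).
Proof.
  intros Dp Dq Hp Hq.
  assert (E1 : d_fun (fun x => f q - f x) i p = mul1 (fun _ => -1) (d_fun f) i p).
  { apply has_d_unique. refine (has_d_comp1 (fun t => f q - t) i f p (-1) _ Dp _ Hp).
    auto_derive; auto. }
  assert (E2 : d_fun (fun y => f y - f p) j q = mul1 (fun _ => 1) (d_fun f) j q).
  { apply has_d_unique. refine (has_d_comp1 (fun t => t - f p) j f q 1 _ Dq _ Hq).
    auto_derive; auto. }
  injection E1 as E11 E12. injection E2 as E21 E22.
  unfold d_prod. rewrite E11, E12, E21, E22.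
  unfold sub4, pr1_form, pr2_form, d_fun; simpl.
  f_equal; f_equal; ring.
Qed.

End Graph.

Theorem theorem5p2 (M : manifold2) (W : web M)
    (gamma : one_form M) (K k a1 a2 : M -> R) (D : M -> Prop)
    (h_gamma : is_connection W gamma)
    (h_K : is_curvature W gamma K)
    (h_K0 : forall p : M, K p <> 0)
    (h_k : smooth_on (fun _ : M => True) k)
    (h_Kk : forall p : M, 0 < k p /\ K p = k p ^ 2)
    (h_a : are_absolute_invariants W gamma k a1 a2)
    (h_D : m_domain D) :
  (functionally_independent D a1 a2 -> coordinate_system D a1 a2 ->
     locally_rigid W D)
  /\
  (functionally_dependent D a1 a2 ->
     (forall p q : M, D p -> D q -> a1 p = a1 q -> p <> q ->
        nonzero_ThetaThetadA W k a1 p q) ->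
     locally_rigid W D).
Proof.
  split.
  (* a1 and a2 agree at p and q, and (a1, a2) is injective on D. *)
  - intros _ [_ [_ [_ [g Hg]]]] p q Dp Dq Npq [U [V [phi [Up [_ [Hphi [Eq Hweb]]]]]]].
    destruct Hphi as [_ [_ [Sphi _]]].
    destruct (chart_cover p) as [i Hi]. destruct (chart_cover q) as [j Hj].
    destruct (invariants_invariant _ _ _ _ _ _ _ h_gamma h_K h_k h_Kk h_a U phi
      Sphi Hweb i j p) as [E1 E2]; [split; [|rewrite Eq]; auto|auto|].
    apply Npq. rewrite Eq in E1, E2.
    destruct (Hg p Dp) as [Gp _]. destruct (Hg q Dq) as [Gq _].
    rewrite <- Gp, <- Gq, E1, E2. reflexivity.
  (* The three covectors restrict to zero on the graph of phi at (p, q). *)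
  - intros _ Hnz p q Dp Dq Npq [U [V [phi [Up [_ [Hphi [Eq Hweb]]]]]]].
    destruct Hphi as [_ [_ [Sphi _]]].
    destruct (chart_cover p) as [i Hi]. destruct (chart_cover q) as [j Hj].
    assert (HO := source_open M U phi Sphi j).
    assert (Op : U p /\ dom j (phi p)) by (rewrite Eq; auto).
    assert (Ia : forall x, U x /\ dom j (phi x) -> dom i x -> a1 (phi x) = a1 x).
    { intros x Ox Dx.
      apply (invariants_invariant _ _ _ _ _ _ _ h_gamma h_K h_k h_Kk h_a U phi
        Sphi Hweb i j x Ox Dx). }
    assert (Da := a1_differentiable _ _ _ _ _ _ _ h_gamma h_k h_Kk h_a).
    assert (P1 := theta1_invariant _ _ _ _ _ h_gamma h_K h_Kk U phi Sphi Hweb i j p Op Hi).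
    assert (P2 := theta2_invariant _ _ _ _ _ h_gamma h_K h_Kk U phi Sphi Hweb i j p Op Hi).
    assert (P3 : pullback_form phi j (d_fun a1) i p = d_fun a1 i p).
    { unfold pullback_form.
      rewrite (pullback_d_fun (fun x => U x /\ dom j (phi x)) phi i j); auto.
      - apply (d_fun_ext i p (fun x => U x /\ dom j (phi x))); auto.
      - intros x H; apply H.
      - intros x [Ux Dx] Dx'. apply Sphi; auto.
      - apply Da, Op. }
    destruct (Hnz p q Dp Dq (eq_trans (eq_sym (Ia p Op Hi)) (f_equal a1 Eq)) Npq i j Hi Hj)
      as [u [v [w N]]].
    apply N. rewrite d_difference by auto.
    rewrite <- (wedge3_graph phi (theta1 W k) (theta2 W k) (d_fun a1) i j p q u v w (eq_sym Eq)).
    unfold Theta, pr1_form. rewrite P1, P2, P3. reflexivity.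
Qed.
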